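(* Let $n\ge 1$ and let $f\colon S^1\to D_n(S^1)$ be an $n$-valued map of degree $n$. Then $R(f)=\infty$.
   Context: $S^1$ is the set of complex numbers of norm one, with universal covering $p\colon\mathbb R\to S^1$, $p(t)=e^{2\pi i t}$, and $\mathbb Z=\pi_1(S^1)$ acting on $\mathbb R$ by translations. $D_n(S^1)$ is the set of $n$-element subsets of $S^1$, topologized as the quotient by the symmetric group $\Sigma_n$ of $F_n(S^1)=\{(x_1,\dots,x_n)\in (S^1)^n\mid x_i\neq x_j\text{ for }i\ne j\}$. An $n$-valued map is a continuous map $f\colon S^1\to D_n(S^1)$; homotopies of $n$-valued maps are continuous maps $S^1\times[0,1]\to D_n(S^1)$. For $d\in\mathbb Z$ let $\phi_{n,d}\colon S^1\to D_n(S^1)$ send $z$ to the set of $n$-th roots of $z^d$. Every $n$-valued map $f\colon S^1\to D_n(S^1)$ is homotopic to $\phi_{n,d}$ for a unique integer $d$, called the degree of $f$ (a known result). Let $F_n(\mathbb R,\mathbb Z)=\{(t_1,\dots,t_n)\in\mathbb R^n\mid t_i-t_j\notin\mathbb Z\text{ for }i\ne j\}$. A lifting of $f$ is a continuous map $\bar f=(\bar f_1,\dots,\bar f_n)\colon\mathbb R\to F_n(\mathbb R,\mathbb Z)$ with $f(p(t))=\{p(\bar f_1(t)),\dots,p(\bar f_n(t))\}$ for all $t$; the coordinate maps $\bar f_i\colon\mathbb R\to\mathbb R$ of all liftings are the lift-factors of $f$. Two lift-factors $g,h$ are equivalent if there is $k\in\mathbb Z$ with $g(t)=k+h(t-k)$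 for all $t$. The Reidemeister number $R(f)$ is the number (possibly $\infty$) of equivalence classes of lift-factors. *)

(* Defs.v *)
From HB Require Import structures.
From mathcomp Require Import all_boot all_order all_algebra.
From mathcomp Require Import perm separable.
From mathcomp Require Import complex.
From mathcomp Require Import all_classical all_reals all_analysis.

Set Implicit Arguments.
Unset Strict Implicit.
Unset Printing Implicit Defensive.

Import Order.TTheory GRing.Theory Num.Theory.
Import numFieldNormedType.Exports.

Local Open Scope classical_set_scope.
Local Open Scope ring_scope.
Local Open Scope complex_scope.

(* F_n(X), a subspace of the product X^n. *)
Definition ordered_conf (n : nat) (X : topologicalType) : topologicalType :=
  set_type [set x : prod_topology (fun _ : 'I_n => X) | injective x].

Definition n_subsets (n : nat) (X : Type) : Type :=
  set_type [set A : set X | (A #= `I_n)%card].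

Lemma card_range_ord (n : nat) (T : Type) (x : 'I_n -> T) :
  injective x -> (range x #= `I_n)%card.
Proof.
move=> xinj.
have -> : `I_n = range (@nat_of_ord n).
  apply/seteqP; split=> [k /= kn|_ /= [i _ <-]]; last exact: ltn_ord.
  by exists (Ordinal kn).
apply: card_eq_trans (inj_card_eq _) _; first by move=> i j _ _; exact: xinj.
by rewrite card_eq_sym; apply: inj_card_eq => i j _ _; exact: val_inj.
Qed.

Section unordered_conf.
Variables (n : nat) (X : topologicalType).

Lemma range_n_subset (x : ordered_conf n X) :
  range (set_val x) \in [set A : set X | (A #= `I_n)%card].
Proof. by case: x => x xP; apply/mem_set/card_range_ord/(set_mem xP). Qed.

Definition to_subset (x : ordered_conf n X) : n_subsets n X :=
  exist _ (range (set_val x)) (range_n_subset x).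

Lemma to_subset_surj (A : n_subsets n X) : exists x, to_subset x = A.
Proof.
case: A => A AP; have /= An := set_mem AP.
move: (An); rewrite card_eq_sym => /card_bijP[g [h gK hK]].
pose o (i : 'I_n) : set_type `I_n := exist _ (i : nat) (mem_set (ltn_ord i)).
have xinj : injective (fun i => set_val (g (o i))).
  by move=> i j /val_inj/(can_inj gK)/(congr1 set_val)/= ?; exact: val_inj.
pose F := [set x : prod_topology (fun _ : 'I_n => X) | injective x].
exists (exist (fun x => x \in F) _ (mem_set (xinj : F _))).
apply: eq_exist => /=; apply/seteqP; split.
  by move=> _ [i _ <-]; exact: set_valP.
move=> a /mem_set Aa; pose b : set_type A := exist _ a Aa.
exists (Ordinal (set_valP (h b))) => //=.
transitivity (set_val (g (h b))); last by rewrite hK.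
by congr (set_val (g _)); exact: val_inj.
Qed.

Definition ordering (A : n_subsets n X) : ordered_conf n X :=
  projT1 (cid (to_subset_surj A)).

Lemma orderingK : cancel ordering to_subset.
Proof. by move=> A; exact: projT2 (cid (to_subset_surj A)). Qed.

(* The fibres of to_subset are the orbits of the symmetric group. *)
Lemma to_subset_eqP (x y : ordered_conf n X) :
  to_subset x = to_subset y <->
  exists s : {perm 'I_n}, forall i, set_val y i = set_val x (s i).
Proof.
case: x y => x xP [y yP]; have /= xinj := set_mem xP.
have /= yinj := set_mem yP; split=> [/(congr1 (@proj1_sig _ _)) /= xyE|[s yE]].
  have ex i : exists j, y i = x j.
    have : range y (y i) by exists i.
    by rewrite -[range y]xyE => -[j _ <-]; exists j.
  have [s sE] := choice ex.
  have sinj : injective s by move=> i j sij; apply: yinj; rewrite !sE sij.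
  by exists (perm sinj) => i; rewrite permE; exact: sE.
apply: eq_exist; apply/seteqP; split=> _ /= [i _ <-].
  by exists (s^-1 i)%g => //; rewrite [LHS]yE permKV.
by exists (s i) => //; rewrite [RHS]yE.
Qed.

HB.instance Definition _ :=
  isQuotient.Build (ordered_conf n X) (n_subsets n X) orderingK.

(* D_n(X) *)
Definition unordered_conf : topologicalType :=
  quotient_topology (n_subsets n X).

(* The generic `val` on a quotient_topology is the choice of a representative,
   hence the explicit name for the underlying subset. *)
Definition points (A : unordered_conf) : set X := proj1_sig (A : n_subsets n X).

End unordered_conf.

Section circle.
Variable R : realType.

Definition circle : topologicalType := set_type [set z : R[i]^o | `|z| = 1].

Lemma expi_circle (x : R) :
  (cos x +i* sin x : R[i]^o) \in [set z : R[i]^o | `|z| = 1].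
Proof. by rewrite inE /= normc_def /= cos2Dsin2 sqrtr1. Qed.

(* p(t) = exp(2 pi i t) *)
Definition circle_cover (t : R) : circle :=
  exist _ (cos (2 * pi * t) +i* sin (2 * pi * t)) (expi_circle (2 * pi * t)).

Definition unit_interval : topologicalType := set_type (`[0, 1]%classic : set R).

Lemma zero_unit_interval : (0 : R) \in (`[0, 1]%classic : set R).
Proof. by rewrite inE /= in_itv /= lexx ler01. Qed.

Lemma one_unit_interval : (1 : R) \in (`[0, 1]%classic : set R).
Proof. by rewrite inE /= in_itv /= lexx ler01. Qed.

Definition I0 : unit_interval := exist _ 0 zero_unit_interval.
Definition I1 : unit_interval := exist _ 1 one_unit_interval.

Definition homotopic (X Y : topologicalType) (f g : X -> Y) : Prop :=
  exists H : X * unit_interval -> Y,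
    [/\ continuous H, forall x, H (x, I0) = f x & forall x, H (x, I1) = g x].

Definition nth_roots (n : nat) (d : int) (z : circle) : set circle :=
  [set w | (set_val w : R[i]) ^+ n = (set_val z : R[i]) ^ d].

Lemma nth_roots_card (n : nat) (n_gt0 : (0 < n)%N) (d : int) (z : circle) :
  nth_roots n d z \in [set A : set circle | (A #= `I_n)%card].
Proof.
rewrite inE /=.
pose c : R[i] := (set_val z : R[i]) ^ d.
have z1 : `|set_val z : R[i]| = 1 by exact: (set_mem (proj2_sig z)).
have c1 : `|c| = 1.
  by rewrite /c; case: (d) => k; rewrite /exprz ?normfV normrX z1 expr1n ?invr1.
have c0 : c != 0 by rewrite -normr_gt0 c1 ltr01.
have [rs Hrs] := closed_field_poly_normal ('X^n - c%:P : {poly R[i]}).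
rewrite lead_coefXnsubC // scale1r in Hrs.
have sz : size rs = n.
  by have := size_XnsubC c n_gt0; rewrite Hrs size_prod_XsubC => -[].
have rsE w : (w \in rs) = (w ^+ n == c).
  by rewrite -root_prod_XsubC -Hrs rootE !hornerE ?hornerXn subr_eq0.
have urs : uniq rs.
  rewrite -separable_prod_XsubC -Hrs unlock derivB derivXn derivC.
  rewrite subr0 -scaler_nat coprimepZr ?pnatr_eq0 -?lt0n //.
  rewrite coprimep_expr // coprimepX.
  by rewrite rootE !hornerE expr0n eqn0Ngt n_gt0 /= sub0r oppr_eq0.
have rsS w : w \in rs -> w \in [set z : R[i]^o | `|z| = 1].
  rewrite rsE => /eqP wc; apply/mem_set => /=; apply/eqP.
  by rewrite -(@pexpr_eq1 _ `|w| n) // -normrX wc c1.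
have rsP (k : 'I_n) : rs`_k \in rs by rewrite mem_nth // sz.
pose x k : circle :=
  exist (fun w => w \in [set z : R[i]^o | `|z| = 1]) _ (rsS _ (rsP k)).
have -> : nth_roots n d z = range x.
  apply/seteqP; split=> w /=.
    move=> /eqP; rewrite -/c -rsE => /(nthP 0)[k].
    rewrite {1}sz => kn wE; exists (Ordinal kn) => //.
    by apply: val_inj.
  by move=> [k _ <-]; apply/eqP; rewrite -[_ == _]rsE; exact: rsP.
apply: card_range_ord => i j /(congr1 (@proj1_sig _ _))/eqP /=.
by rewrite nth_uniq ?sz // => /eqP/val_inj.
Qed.

Definition phi (n : nat) (n_gt0 : (0 < n)%N) (d : int) (z : circle) :
    unordered_conf n circle :=
  exist _ (nth_roots n d z) (nth_roots_card n_gt0 d z).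

(* Every n-valued map is homotopic to phi for exactly one d, its degree. *)
Definition has_degree (n : nat) (n_gt0 : (0 < n)%N)
    (f : circle -> unordered_conf n circle) (d : int) : Prop :=
  homotopic f (phi n_gt0 d).

(* F_n(R, Z), a subspace of R^n. *)
Definition conf_mod_int (n : nat) : topologicalType :=
  set_type [set t : prod_topology (fun _ : 'I_n => R) |
    forall i j, i != j -> t i - t j \isn't a Num.int].

Definition lifting (n : nat) (f : circle -> unordered_conf n circle)
    (F : R -> conf_mod_int n) : Prop :=
  continuous F /\
  forall t, points (f (circle_cover t)) =
            [set circle_cover (set_val (F t) i) | i in [set: 'I_n]].

Definition lift_factor (n : nat) (f : circle -> unordered_conf n circle) :
    set (R -> R) :=
  [set g | exists F i, lifting f F /\ g = (fun t => set_val (F t) i)].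

Definition lift_equiv (g h : R -> R) : Prop :=
  exists k : int, forall t, g t = k%:~R + h (t - k%:~R).

Definition Reidemeister_classes (n : nat)
    (f : circle -> unordered_conf n circle) : set (set (R -> R)) :=
  [set [set g | lift_factor f g /\ lift_equiv g h] | h in lift_factor f].

Definition Reidemeister_number (n : nat)
    (f : circle -> unordered_conf n circle) : \bar R :=
  counting (Reidemeister_classes f).

End circle.

(* Main.v *)
Require Import Defs.
From mathcomp Require Import all_boot all_order all_algebra.
From mathcomp Require Import complex.
From mathcomp Require Import zify ring lra.
From mathcomp Require Import all_classical all_reals all_analysis.

Set Implicit Arguments.
Unset Strict Implicit.
Unset Printing Implicit Defensive.

Import Order.TTheory GRing.Theory Num.Theory.
Import numFieldNormedType.Exports.

Local Open Scope classical_set_scope.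
Local Open Scope ring_scope.
Local Open Scope complex_scope.

(** A map of degree [n] has liftings each of whose coordinates advances by
    exactly [1] over a period, and this is precisely what makes the equivalence
    of lift-factors trivial on them.  Say that a lifting [g] of a loop in
    [D_n(S^1)] is equivariant when [g_i (t + 1) = g_i t + 1] for all [i].  The
    model map, which sends [z] to the [n]-th roots of [z ^ n], has the
    equivariant lifting [t + i / n].  If [g] is any equivariant lifting then so
    is [g + m] for each integer [m]; and a coordinate satisfies
    [k + (g_i (t - k) + m) = g_i t + m], so its equivalence class contains no
    other integer translate of [g_i].  Hence the lift-factors [g_0 + m] lie in
    infinitely many classes, and everything reduces to carrying an equivariant
    lifting along a homotopy.

    This is done without a homotopy lifting theorem.  For [A] in [D_n(S^1)] let
    [angles A] be the preimage of [A] in the real line, a union of [n] classes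
    modulo the integers.  Because [A] has exactly [n] points, every [B] close to
    [A] has exactly one angle near each angle of [A], and the angles of [B]
    stay uniformly far apart ([angles_local]).  By compactness of a period this
    is uniform in [t] for a homotopy [K (t, s)], when [s] is near a fixed [s0].
    Moving each coordinate of an equivariant lifting to the nearest angle of a
    nearby loop then gives an equivariant lifting of that loop: uniqueness of
    the nearest angle yields continuity, injectivity modulo the integers and
    equivariance alike ([equivariant_lift_near]).  So the set of [s] for which
    the loop [K (-, s)] has an equivariant lifting is open and closed, hence is
    the whole line as soon as it is nonempty
    ([homotopic_equivariant_lift]). *)

(** * Functions of period one *)

Lemma periodic_addz (R : pzRingType) (T : Type) (h : R -> T) :
  (forall t, h (t + 1) = h t) -> forall t (k : int), h (t + k%:~R) = h t.
Proof.
move=> h1; have hn t (k : nat) : h (t + k%:R) = h t.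
  by elim: k => [|k IH]; rewrite ?addr0 // -natr1 addrA h1.
move=> t [k|k]; first by rewrite -pmulrn hn.
by rewrite NegzE mulrNz -pmulrn -(hn (t - _) k.+1) subrK.
Qed.

(** * The covering of the circle by the line *)

Section circle_cover.
Variable R : realType.
Implicit Types (a b t x y : R) (w z : circle R).
Local Notation p := (@circle_cover R).

Definition xcoord w : R := complex.Re (set_val w : R[i]).
Definition ycoord w : R := complex.Im (set_val w : R[i]).

Lemma circle_norm w : xcoord w ^+ 2 + ycoord w ^+ 2 = 1.
Proof.
rewrite /xcoord /ycoord; case: w => -[x y] /set_mem /=.
rewrite normc_def /= => /(congr1 (@complex.Re R)) /= h.
by rewrite -(sqr_sqrtr (a := x ^+ 2 + y ^+ 2)) ?h ?expr1n // addr_ge0 // sqr_ge0.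
Qed.

Lemma circle_ext w z : xcoord w = xcoord z -> ycoord w = ycoord z -> w = z.
Proof.
rewrite /xcoord /ycoord => h1 h2; apply: val_inj; move: h1 h2.
by case: w => -[x y] ?; case: z => -[? ?] ? /= -> ->.
Qed.

Lemma xcoord_cover t : xcoord (p t) = cos (2 * pi * t). Proof. by []. Qed.
Lemma ycoord_cover t : ycoord (p t) = sin (2 * pi * t). Proof. by []. Qed.

Lemma sin_pi_eq0 x : 0 <= x < 1 -> sin (pi * x) = 0 -> x = 0.
Proof.
case/andP=> x0 x1 h; apply/eqP; rewrite eq_le x0 andbT leNgt; apply/negP => xp.
have : 0 < sin (pi * x).
  apply: sin_gt0_pi; rewrite mulr_gt0 ?pi_gt0 //= -[ltRHS]mulr1.
  by rewrite ltr_pM2l ?pi_gt0.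
by rewrite h ltxx.
Qed.

Lemma circle_cover1 t : p (t + 1) = p t.
Proof.
have e : 2 * pi * (t + 1) = 2 * pi * t + pi *+ 2 by ring.
by apply: circle_ext; rewrite !(xcoord_cover, ycoord_cover) e ?cosD2pi ?sinD2pi.
Qed.

Lemma circle_coverDz t (k : int) : p (t + k%:~R) = p t.
Proof. exact: periodic_addz circle_cover1 t k. Qed.

Lemma circle_cover_eqP a b : p a = p b <-> a - b \is a Num.int.
Proof.
split=> [h|/intrP[k e]]; last by rewrite -[a](subrK b) e addrC circle_coverDz.
pose u := a - b; pose r := u - (Num.floor u)%:~R.
have r01 : 0 <= r < 1.
  by have := floor_itv u; rewrite /r intrD mulr1z; lra.
have pr : p r = p u by rewrite /r -mulrNz circle_coverDz.
have cu : cos (2 * pi * u) = 1.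
  have hc := congr1 xcoord h; have hs := congr1 ycoord h.
  rewrite !xcoord_cover !ycoord_cover in hc hs.
  rewrite /u mulrBr cosB hc hs -!expr2; exact: cos2Dsin2.
have cr : cos (2 * pi * r) = 1 by rewrite -xcoord_cover pr xcoord_cover.
have sr : sin (pi * r) = 0.
  apply/eqP; rewrite -sqrf_eq0; have := cos2Dsin2 (pi * r).
  have e : 2 * pi * r = pi * r + pi * r by ring.
  by move: cr; rewrite e cosD; lra.
move/sin_pi_eq0: sr => /(_ r01)/eqP; rewrite subr_eq0 -/u => /eqP ->.
exact: intr_int.
Qed.

Lemma circle_cover_surj w : exists t, p t = w.
Proof.
have n1 := circle_norm w; have x1 : -1 <= xcoord w <= 1.
  rewrite -ler_norml -(@expr_le1 _ 2) // real_normK ?num_real //.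
  by have := sqr_ge0 (ycoord w); lra.
have s1 : sin (acos (xcoord w)) = `|ycoord w|.
  by rewrite sin_acos // -n1 addrC addKr sqrtr_sqr.
have k u : 2 * pi * (u / (2 * pi)) = u :> R.
  by rewrite mulrCA divff ?mulr1 // mulf_neq0 // gt_eqF ?pi_gt0.
have [y0|y0] := leP 0 (ycoord w).
  exists (acos (xcoord w) / (2 * pi)).
  apply: circle_ext; rewrite (xcoord_cover, ycoord_cover) k.
    by rewrite acosK.
  by rewrite s1 ger0_norm.
exists (- acos (xcoord w) / (2 * pi)).
apply: circle_ext; rewrite (xcoord_cover, ycoord_cover) k.
  by rewrite cosN acosK.
by rewrite sinN s1 ltr0_norm ?opprK.
Qed.

Definition cos_between w z : R := xcoord w * xcoord z + ycoord w * ycoord z.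

Lemma cos_between_cover a b : cos_between (p a) (p b) = cos (2 * pi * (a - b)).
Proof. by rewrite mulrBr cosB. Qed.

Lemma circle_ball w z (e : R) : 0 < e ->
  ball (set_val z : R[i]^o) e%:C (set_val w : R[i]^o) =
    (2 - 2 * cos_between w z < e ^+ 2) :> Prop.
Proof.
move=> e0; have := circle_norm w; have := circle_norm z.
rewrite /ball /= distrC /cos_between /xcoord /ycoord.
move: (set_val w : R[i]) (set_val z : R[i]) => [x y] [u v] /= n1 n2.
rewrite normc_def /= ltcR.
rewrite -[X in _ < X](ger0_norm (ltW e0)) -sqrtr_sqr ltr_sqrt ?exprn_gt0 //.
congr (is_true (_ < _)); lra.
Qed.

(** Measuring closeness by the cosine of the angle between two points avoids
    square roots and turns under [circle_cover] into [cos]. *)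
Lemma nbhs_circleP z (U : set (circle R)) :
  nbhs z U <-> exists2 e : R, 0 < e & forall w, 1 - e < cos_between w z -> U w.
Proof.
split=> [[_ [[V oV <-] /= Vz VU]]|[e e0 eU]].
  have : nbhs (set_val z : R[i]^o) V by exact: open_nbhs_nbhs.
  move=> /nbhs_ballP[/= [e e']]; rewrite ltcE /= => /andP[/eqP -> e0] eV.
  exists (e ^+ 2 / 2); first by rewrite divr_gt0 // exprn_gt0.
  move=> w wz; apply: VU; apply: eV => /=.
  rewrite circle_ball //; lra.
have [d d0 d2] : exists2 d : R, 0 < d & d ^+ 2 = 2 * e.
  exists (Num.sqrt (2 * e)); first by rewrite sqrtr_gt0 mulr_gt0.
  by rewrite sqr_sqrtr // mulr_ge0 // ltW.
have : nbhs (set_val z : R[i]^o) (ball (set_val z : R[i]^o) (d%:C)).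
  by apply: nbhsx_ballx; rewrite ltcR.
rewrite !nbhsE => -[V [oV Vz] VB].
exists (set_val @^-1` V); first by split=> //; exists V.
move=> w /= /VB.
rewrite circle_ball // => dz; apply: eU; lra.
Qed.

Lemma circle_cover_continuous : continuous p.
Proof.
move=> a U /nbhs_circleP[e e0 eU].
have h : (fun t => 2 * pi * (t - a)) @ a --> 2 * pi * (a - a).
  by apply: cvgMl_tmp; apply: cvgB; [exact: cvg_id|exact: cvg_cst].
have := cvg_comp _ _ h (@continuous_cos R _); rewrite subrr mulr0 cos0.
move=> /cvgr_gt /(_ (1 - e)); rewrite ltrBlDr ltrDl => /(_ e0).
by apply: filterS => t te; apply: eU; rewrite cos_between_cover.
Qed.

(** Write a point [w] near [p a] as [p a] rotated by an angle of cosine [c] and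
    sine [s].  As [c] is positive this angle is [asin s], and
    [a + asin s / (2 * pi)] is a preimage of [w] depending continuously on
    [s]. *)
Lemma circle_cover_open a (e : R) : 0 < e ->
  \forall w \near p a, exists2 b, `|b - a| < e & p b = w.
Proof.
move=> e0.
have : (@asin R) y @[y --> 0] --> asin (0 : R).
  by apply: continuous_asin; rewrite ltrN10 ltr01.
have -> : asin (0 : R) = 0.
  by rewrite -[X in asin X]sin0 sinK // in_itv /= oppr_le0 divr_ge0 ?pi_ge0.
have pi2 : 0 < 2 * pi :> R by rewrite mulr_gt0 ?pi_gt0.
move=> /cvgr0Pnorm_lt /(_ (e * (2 * pi)) (mulr_gt0 e0 pi2)).
move=> /nbhs_ballP[/= d d0 dE].
have [d' [d'0 d'1 d'd]] : exists d' : R, [/\ 0 < d', d' < 1 & d' <= d].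
  exists (Num.min d (1 / 2)); split; last by rewrite ge_min lexx.
    by rewrite lt_min d0 /=; lra.
  by rewrite gt_min; apply/orP; right; lra.
(* The bound makes s ^ 2 = (1 - c) (1 + c) <= 2 (1 - c) smaller than d' ^ 2. *)
apply/nbhs_circleP; exists (d' ^+ 2 / 2).
  by rewrite divr_gt0 // exprn_gt0.
move=> w; set c := cos_between w (p a) => cd.
pose s := ycoord w * xcoord (p a) - xcoord w * ycoord (p a).
have cs1 : c ^+ 2 + s ^+ 2 = 1.
  have := circle_norm w; have := circle_norm (p a) => na nw.
  transitivity ((xcoord w ^+ 2 + ycoord w ^+ 2) *
    (xcoord (p a) ^+ 2 + ycoord (p a) ^+ 2)).
    by rewrite /c /s /cos_between; ring.
  by rewrite na nw mulr1.
have c0 : 0 < c.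
  have : d' ^+ 2 <= 1 by rewrite expr_le1 // ltW.
  lra.
have s2 : s ^+ 2 < d' ^+ 2 by have := sqr_ge0 (1 - c); lra.
have sd : `|s| < d' by rewrite ltr_norml; apply/andP; split; nra.
have s11 : -1 <= s <= 1 by rewrite -ler_norml ltW // (lt_trans sd).
have k u : 2 * pi * (u / (2 * pi)) = u :> R.
  by rewrite mulrCA divff ?mulr1 // gt_eqF.
have sinE : sin (asin s) = s by rewrite asinK.
have cosE : cos (asin s) = c.
  by rewrite cos_asin // -cs1 addrK sqrtr_sqr gtr0_norm.
exists (a + asin s / (2 * pi)).
  rewrite addrAC subrr add0r normrM normfV (gtr0_norm pi2) ltr_pdivrMr //.
  by apply: dE; rewrite /ball /= sub0r normrN (lt_le_trans sd).
apply: circle_ext.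
  rewrite xcoord_cover mulrDr k cosD cosE sinE -xcoord_cover -ycoord_cover.
  rewrite /c /s /cos_between.
  have := circle_norm (p a) => na.
  transitivity (xcoord w * (xcoord (p a) ^+ 2 + ycoord (p a) ^+ 2)).
    by ring.
  by rewrite na mulr1.
rewrite ycoord_cover mulrDr k sinD cosE sinE -xcoord_cover -ycoord_cover.
rewrite /c /s /cos_between.
have := circle_norm (p a) => na.
transitivity (ycoord w * (xcoord (p a) ^+ 2 + ycoord (p a) ^+ 2)).
  by ring.
by rewrite na mulr1.
Qed.

Lemma val_circle_cover t :
  (set_val (p t) : R[i]) = cos (2 * pi * t) +i* sin (2 * pi * t).
Proof. by []. Qed.

Lemma circle_coverM a b :
  (set_val (p (a + b)) : R[i]) = (set_val (p a) : R[i]) * set_val (p b).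
Proof.
rewrite !val_circle_cover mulrDr cosD sinD; simpc.
by congr (_ +i* _); rewrite addrC.
Qed.

Lemma circle_coverX a (k : nat) :
  (set_val (p (k%:R * a)) : R[i]) = (set_val (p a) : R[i]) ^+ k.
Proof.
elim: k => [|k IH]; first by rewrite mul0r val_circle_cover mulr0 cos0 sin0.
by rewrite -natr1 mulrDl mul1r circle_coverM IH exprSr.
Qed.

End circle_cover.

(** * Configurations of [n] unordered points *)

Section n_subsets.
Variables (n : nat) (X : topologicalType).
Implicit Types (A : unordered_conf n X) (U : set X).

Lemma points_enum A : exists2 x : 'I_n -> X, injective x & points A = range x.
Proof.
have [x xA] := to_subset_surj A; exists (set_val x); last by rewrite -xA.
exact: (set_valP x).
Qed.

(** Counting is what makes nearby configurations correspond point by point: [n]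
    distinct points found in [A] leave no room for another one. *)
Lemma points_exhaust A (y : 'I_n -> X) :
  injective y -> (forall i, points A (y i)) -> points A = range y.
Proof.
have [x xinj ->] := points_enum A => yinj yx.
have ex i : exists j, y i = x j by have [j _ <-] := yx i; exists j.
have [s sE] := choice ex.
have sinj : injective s by move=> i j sij; apply: yinj; rewrite !sE sij.
apply/seteqP; split=> [_ [j _ <-]|_ [i _ <-]]; last exact: yx.
by exists (invF sinj j) => //; rewrite sE f_invF.
Qed.

(** Together with the number of points, these open sets are enough to follow
    the points of a configuration that varies continuously. *)
Lemma open_meets U : open U ->
  open [set A : unordered_conf n X | points A `&` U !=set0].
Proof.
move=> oU; have piE (x : ordered_conf n X) :
    points (\pi_(n_subsets n X)%qT x : unordered_conf n X) = range (set_val x).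
  by rewrite !unlock.
rewrite /open /= /quotient_open.
have -> : \pi_(quotient_topology (n_subsets n X))%qT @^-1`
    [set A : unordered_conf n X | points A `&` U !=set0] =
    \bigcup_(i in [set: 'I_n]) [set x : ordered_conf n X | U (set_val x i)].
  apply/seteqP; split=> x; rewrite /preimage /= piE.
    by case=> y [[i _ <-] Ui]; exists i.
  by move=> [i _ Ui]; exists (set_val x i); split=> //; exists i.
apply: bigcup_open => i _.
have c : continuous (fun x : ordered_conf n X => set_val x i).
  move=> x; apply: (@cvg_comp _ _ _ set_val (fun z : prod_topology _ => z i)).
    exact: initial_continuous.
  exact: (@proj_continuous _ (fun=> X)).
exact: (open_comp (fun x _ => c x) oU).
Qed.

End n_subsets.

(** * Angles of a configuration on the circle *)

Section angles.
Variables (R : realType) (n : nat).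
Implicit Types (A B : unordered_conf n (circle R)) (a b e : R) (x y : 'I_n -> R).
Local Notation p := (@circle_cover R).

Definition angles A : set R := [set a | points A (p a)].

Definition distinct_mod_int x := forall i j, i != j -> x i - x j \isn't a Num.int.

Lemma distinct_mod_int_inj x : distinct_mod_int x -> injective (p \o x).
Proof.
move=> xd i j /= /circle_cover_eqP xij; apply/eqP/negPn/negP => /xd.
by rewrite xij.
Qed.

Lemma angles_enum A :
  exists2 x, distinct_mod_int x & forall i, angles A (x i).
Proof.
have [w winj AE] := points_enum A.
have [x xE] := choice (fun i => circle_cover_surj (w i)).
exists x => [i j|i]; last by rewrite /angles /= xE AE; exists i.
apply: contra => /circle_cover_eqP; rewrite !xE => /winj ->; exact: eqxx.
Qed.

Lemma angles_exhaust A x : distinct_mod_int x -> (forall i, angles A (x i)) ->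
  forall a, angles A a -> exists i (m : int), a = x i + m%:~R.
Proof.
move=> xd xA a; have := points_exhaust (distinct_mod_int_inj xd) xA.
rewrite /angles /= => -> [i _ /= /esym/circle_cover_eqP/intrP[m e]].
by exists i, m; rewrite -e addrC subrK.
Qed.

Lemma angles_addz A a (m : int) : angles A a -> angles A (a + m%:~R).
Proof. by rewrite /angles /= circle_coverDz. Qed.

Lemma angles_near A a e : angles A a -> 0 < e ->
  \forall B \near A, exists2 b, angles B b & `|b - a| < e.
Proof.
move=> Aa e0.
have : nbhs (p a) [set w | exists2 b, `|b - a| < e & p b = w].
  exact: circle_cover_open.
rewrite nbhsE => -[U [oU Ua] UE].
have : nbhs A [set B | points B `&` U !=set0].
  by apply: open_nbhs_nbhs; split; [exact: open_meets|exists (p a)].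
apply: filterS => B /= [w [Bw /UE[b ba bw]]].
by exists b => //; rewrite /angles /= bw.
Qed.

(** The pair [i = j] is included: it bounds the gap by the distance [1] between
    two angles of one and the same point. *)
Lemma distinct_mod_int_gap x : distinct_mod_int x -> exists2 d : R, 0 < d &
  forall i j (m : int), `|x i - x j - m%:~R| < d -> i = j /\ m = 0.
Proof.
move=> xd.
have : \forall d \near (0 : R)^'+, forall (ij : 'I_n * 'I_n) (m : int),
    `|x ij.1 - x ij.2 - m%:~R| < d -> ij.1 = ij.2 /\ m = 0.
  apply: filter_forall => -[i j] /=; have [<-|/xd ij] := eqVneq i j.
    near=> d => m; rewrite subrr sub0r normrN -intr_norm => md; split=> //.
    apply/eqP; rewrite -normr_eq0 eq_le normr_ge0 andbT leNgt gtz0_ge1.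
    apply/negP => m1; have : 1 < d.
      by apply: le_lt_trans md; rewrite (ler_int R 1).
    by apply/negP; rewrite -leNgt; near: d; exact: nbhs_right_ltW.
  set u := x i - x j; set f : R := (Num.floor u)%:~R.
  have fu : f < u < f + 1.
    have := floor_itv u; rewrite intrD mulr1z -/f => /andP[fu ->]; rewrite andbT.
    rewrite lt_neqAle fu andbT; apply: contra ij => /eqP; rewrite -/u => <-.
    exact: intr_int.
  near=> d => m md; exfalso.
  have d1 : d < u - f by near: d; apply: nbhs_right_lt; lra.
  have d2 : d < f + 1 - u by near: d; apply: nbhs_right_lt; lra.
  have [mf|fm] := leP m (Num.floor u).
    have : (m%:~R : R) <= f by rewrite ler_int.
    by move: md; rewrite ltr_norml; lra.
  have : f + 1 <= (m%:~R : R) by rewrite /f -[1]/(1%:~R) -intrD ler_int lezD1.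
  by move: md; rewrite ltr_norml; lra.
move=> h; have [d [d0 dP]] : exists d : R, 0 < d /\ forall ij : 'I_n * 'I_n,
    forall m : int, `|x ij.1 - x ij.2 - m%:~R| < d -> ij.1 = ij.2 /\ m = 0.
  apply: (@filter_ex _ (0 : R)^'+); apply: filterI h; exact: nbhs_right_gt.
by exists d => // i j m; exact: (dP (i, j)).
Unshelve. all: by end_near. Qed.

Definition separated_by e A :=
  forall a b, angles A a -> angles A b -> `|a - b| < e -> a = b.

Definition close_to e A B :=
  forall a, angles A a -> exists2 b, angles B b & `|b - a| < e.

Lemma close_sym_trans A B C e : close_to (e / 2) A B -> close_to (e / 2) B C ->
  close_to e A C.
Proof.
move=> AB BC a /AB[b Bb ab]; have [c Cc bc] := BC _ Bb; exists c => //.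
have -> : c - a = (c - b) + (b - a) by ring.
by rewrite (le_lt_trans (ler_normD _ _)) // [e]splitr ltrD.
Qed.

(** Near [A], each of [n] representatives [x_i] of the angles of [A] has an
    angle [y_i] of [B] close to it.  If [d0] is the gap between distinct angles
    of [A] and the [y_i] are within [d0 / 3] of the [x_i], then the [y_i] are
    still [d0 / 3] apart modulo the integers, so they represent all the angles
    of [B], and the correspondence works both ways. *)
Lemma angles_local A : exists2 d : R, 0 < d & forall e, 0 < e <= d ->
  \forall B \near A, [/\ separated_by d B, close_to e A B & close_to e B A].
Proof.
have [x xd xA] := angles_enum A.
have [d0 d00 gap] := distinct_mod_int_gap xd.
exists (d0 / 3); first by rewrite divr_gt0.
move=> e /andP[e0 ed].
have near_x := @filter_forall _ _ _ (nbhs A) (nbhs_filter A)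
  (fun i => angles_near (xA i) e0).
apply: (@filterS _ (nbhs A) (nbhs_filter A) _ _ _ near_x) => B near_xB.
have yP i := cid2 (near_xB i).
pose y i := projT1 (yP i).
have yB i : angles B (y i) by rewrite /y; case: (yP i).
have yx i : `|y i - x i| < e by rewrite /y; case: (yP i).
have gapy i j (m : int) : `|y i - y j - m%:~R| < d0 / 3 -> i = j /\ m = 0.
  by move=> h; apply: gap; move: h (yx i) (yx j); rewrite !ltr_norml; lra.
have yd : distinct_mod_int y.
  move=> i j ij; apply/negP => /intrP[m e']; case: (gapy i j m) => [|/eqP].
    by rewrite e' subrr normr0 divr_gt0.
  by rewrite (negbTE ij).
split.
- move=> a b /(angles_exhaust yd yB)[i [k ->]].
  move=> /(angles_exhaust yd yB)[j [l ->]] h.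
  case: (gapy i j (l - k)); last by move=> -> /eqP; rewrite subr_eq0 => /eqP ->.
  by move: h; congr (`| _ | < _); rewrite intrD mulrNz; ring.
- move=> a /(angles_exhaust xd xA)[i [k ->]].
  exists (y i + k%:~R); first exact: angles_addz.
  by rewrite opprD addrACA subrr addr0.
- move=> a /(angles_exhaust yd yB)[i [k ->]].
  exists (x i + k%:~R); first exact: angles_addz.
  by rewrite opprD addrACA subrr addr0 distrC.
Qed.

End angles.

(** * Equivariant liftings along a homotopy *)

Section equivariant_lift.
Variables (R : realType) (n : nat).
Implicit Types (A B : unordered_conf n (circle R)) (a b e t s : R).
Implicit Types (L : R -> unordered_conf n (circle R)) (g : 'I_n -> R -> R).

Definition equivariant_lift L g :=
  [/\ forall i, continuous (g i), forall i t, angles (L t) (g i t),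
      forall t, distinct_mod_int (g^~ t) & forall i t, g i (t + 1) = g i t + 1].

(** Angles of [L t] are at least [4 e] apart, and likewise for [L' t], so at
    most one angle of [L' t] is within [e] of a given angle of [L t].  Choosing
    it for each [g_i t] defines the new lifting, and each of its properties
    follows by recognizing a candidate that is close enough. *)
Lemma equivariant_lift_near L L' g e : continuous L' -> 0 < e ->
  (forall t, L' (t + 1) = L' t) ->
  (forall t, separated_by (4 * e) (L t)) ->
  (forall t, separated_by (4 * e) (L' t)) ->
  (forall t, close_to e (L t) (L' t)) ->
  equivariant_lift L g -> exists g', equivariant_lift L' g'.
Proof.
move=> L'c e0 L'1 sepL sepL' LL' [gc gL gd g1].
have ex (it : 'I_n * R) :
    exists a, angles (L' it.2) a /\ `|a - g it.1 it.2| < e.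
  by have [b Lb gb] := LL' _ _ (gL it.1 it.2); exists b.
have [h hP] := choice ex.
pose g' i t := h (i, t).
have g'L i t : angles (L' t) (g' i t) by case: (hP (i, t)).
have g'g i t : `|g' i t - g i t| < e by case: (hP (i, t)).
exists g'; split=> //.
- move=> i t; apply/cvgrPdist_lt => d d0.
  pose d' := Num.min d e.
  have d'0 : 0 < d' by rewrite lt_min d0.
  have /cvgrPdist_lt/(_ e e0) near_g := gc i t.
  have := L'c t _ (angles_near (g'L i t) d'0).
  move: near_g; apply: filterS2 => t' gt [b L'b]; rewrite lt_min => /andP[bd be].
  suff -> : g' i t' = b by rewrite distrC.
  apply: (sepL' t') => //; move: gt be (g'g i t) (g'g i t').
  by rewrite !ltr_norml; lra.
- move=> t i j ij; apply/negP => /intrP[m g'm].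
  have /negP := gd t _ _ ij; apply; apply/intrP; exists m.
  suff : g i t = g j t + m%:~R by move=> ->; rewrite addrAC subrr add0r.
  apply: (sepL t) => //; first exact: angles_addz.
  move: (g'g i t) (g'g j t); rewrite !ltr_norml; lra.
- move=> i t; apply: (sepL' (t + 1)) => //.
    by rewrite L'1; apply: (angles_addz 1).
  move: (g'g i (t + 1)) (g'g i t); rewrite g1 !ltr_norml; lra.
Qed.

Variable K : R * R -> unordered_conf n (circle R).
Hypothesis Kc : continuous K.
Hypothesis K1 : forall t s, K (t + 1, s) = K (t, s).

Lemma K_addz t s (k : int) : K (t + k%:~R, s) = K (t, s).
Proof. exact: (@periodic_addz _ _ (fun t => K (t, s))). Qed.

(** The tube lemma over the compact interval [0, 1], spread over the line by
    periodicity. *)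
Lemma near_all_of_periodic (I : Type) (F : set_system I) (P : I -> R -> Prop) :
  Filter F -> (forall i t (k : int), P i (t + k%:~R) -> P i t) ->
  (forall t0, \forall t \near t0 & i \near F, P i t) ->
  \forall i \near F, forall t, P i t.
Proof.
move=> FF Pk Ploc; have /compact_near_coveringP cov := @segment_compact R 0 1.
have := cov I F P FF (fun t0 _ => Ploc t0).
apply: filterS => i Pi t; apply: (Pk i t (- Num.floor t)); apply: Pi.
have := floor_itv t; rewrite /= in_itv /= mulrNz intrD mulr1z; lra.
Qed.

(** The separation [d] must be made uniform in [t] before the closeness
    [d / 4] can be asked for, hence two successive uses of compactness. *)
Lemma equivariant_lift_locally_constant s0 : \forall s \near s0,
  (exists g, equivariant_lift (fun t => K (t, s)) g) <->
  (exists g, equivariant_lift (fun t => K (t, s0)) g).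
Proof.
have [d d0 sepK] : exists2 d, 0 < d &
    \forall s \near s0, forall t, separated_by d (K (t, s)).
  have : filter_prod (nbhs s0) (0 : R)^'+
      [set sd | forall t, separated_by sd.2 (K (t, sd.1))].
    apply: (@near_all_of_periodic _ (filter_prod (nbhs s0) (0 : R)^'+)
        (fun sd t => separated_by sd.2 (K (t, sd.1))) _) => [sd t k|t0].
      by rewrite K_addz.
    have [d d0 dP] := angles_local (K (t0, s0)).
    have dd : 0 < d <= d by rewrite d0 lexx.
    have [[U V] /= [Ut Vs] UVP] := Kc (dP d dd).
    exists (U, [set sd | V sd.1 /\ sd.2 <= d]) => /=.
      split=> //; exists (V, [set d' | d' <= d]) => //=; split=> //.
      exact: nbhs_right_ltW.
    move=> [t [s d']] /= [Ut' [Vs' d'd]] a b La Lb ab.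
    have [sep _ _] := UVP (t, s) (conj Ut' Vs').
    by apply: sep => //; exact: lt_le_trans d'd.
  move=> [[V W] /= [Vs W0] VWP].
  have [d [Wd d0]] := filter_ex (filterI W0 (nbhs_right_gt 0)).
  exists d => //; apply: filterS Vs => s Vs.
  exact: (VWP (s, d) (conj Vs Wd)).
have e0 : 0 < d / 4 by rewrite divr_gt0.
have closeK : \forall s \near s0, forall t,
    close_to (d / 4) (K (t, s)) (K (t, s0)) /\
    close_to (d / 4) (K (t, s0)) (K (t, s)).
  apply: (@near_all_of_periodic _ (nbhs s0)
      (fun s t => close_to (d / 4) (K (t, s)) (K (t, s0)) /\
        close_to (d / 4) (K (t, s0)) (K (t, s))) _) => [s t k|t0].
    by rewrite !K_addz.
  have [c c0 cP] := angles_local (K (t0, s0)).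
  have cc : 0 < Num.min (d / 8) c <= c.
    by rewrite lt_min c0 ge_min lexx orbT divr_gt0.
  have [[U V] /= [Ut Vs] UVP] := Kc (cP _ cc).
  have close A B : close_to (Num.min (d / 8) c) A B -> close_to (d / 4 / 2) A B.
    move=> AB a /AB[b Bb]; rewrite lt_min => /andP[ba _]; exists b => //.
    by rewrite (_ : d / 4 / 2 = d / 8) //; field.
  exists (U, V) => //= -[t s] /= [Ut' Vs'].
  have [_ /close c1 /close c2] := UVP (t, s) (conj Ut' Vs').
  have [_ /close c3 /close c4] := UVP (t, s0) (conj Ut' (nbhs_singleton Vs)).
  by split; [exact: close_sym_trans c2 c3|exact: close_sym_trans c4 c1].
have Kct s : continuous (fun t => K (t, s)).
  move=> t; apply: (@continuous_comp _ _ _ (fun t => (t, s)) K); last exact: Kc.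
  move=> Y [[U V] /= [Ut Vs] UV].
  apply: (@filterS _ (nbhs t) _ _ _ _ Ut) => u Uu.
  by apply: UV; split=> //; exact: nbhs_singleton Vs.
have d4 : 4 * (d / 4) = d by rewrite mulrC divfK.
near=> s; have seps : forall t, separated_by (4 * (d / 4)) (K (t, s)).
  by rewrite d4; near: s.
have seps0 : forall t, separated_by (4 * (d / 4)) (K (t, s0)).
  by rewrite d4; exact: nbhs_singleton sepK.
have cl : forall t, close_to (d / 4) (K (t, s)) (K (t, s0)) /\
    close_to (d / 4) (K (t, s0)) (K (t, s)) by near: s.
split=> -[g]; apply: (equivariant_lift_near (Kct _) e0) => //.
- by move=> t; case: (cl t).
- by move=> t; case: (cl t).
Unshelve. all: by end_near. Qed.

End equivariant_lift.

Lemma locally_constant_all (R : realType) (P : R -> Prop) (a : R) :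
  (forall s0, \forall s \near s0, P s <-> P s0) -> P a -> forall b, P b.
Proof.
move=> Ploc Pa b.
have cR : connected [set: R] by apply/connected_intervalP => x y z.
have -> // : P b = [set: R] b; rewrite -[P b]/([set s | P s] b).
rewrite (cR [set s | P s]) //.
- by exists a.
- exists [set s | P s]; last by rewrite setTI.
  rewrite openE => s Ps; rewrite /interior; apply: filterS (Ploc s) => t /=.
  by move=> [_]; exact.
- exists [set s | P s]; last by rewrite setTI.
  rewrite -openC openE => s Ps; apply: filterS (Ploc s) => t /= [+ _] Pt.
  by move=> /(_ Pt).
Qed.

Lemma prod_topology_continuous (I : eqType) (X Y : topologicalType)
    (F : X -> I -> Y) :
  (forall i, continuous (F^~ i)) ->
  continuous (F : X -> prod_topology (fun _ : I => Y)).
Proof.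
move=> Fc x; apply/cvg_sup => i U [_ [[W oW <-] /= Wx WU]].
have := Fc i x _ (open_nbhs_nbhs (conj oW Wx)).
by apply: (@filterS _ (nbhs x)) => u; exact: WU.
Qed.

Section clamp.
Variable R : realType.

Lemma clamp_subproof (s : R) :
  Num.max 0 (Num.min 1 s) \in (`[0, 1]%classic : set R).
Proof. by rewrite inE /= in_itv /= le_max lexx ge_max ler01 ge_min lexx. Qed.

(** A retraction of the line onto the unit interval, so that homotopies become
    families indexed by all reals. *)
Definition clamp s : unit_interval R :=
  exist (fun x => x \in (`[0, 1]%classic : set R)) _ (clamp_subproof s).

Lemma clamp0 : clamp 0 = @I0 R.
Proof. by apply: val_inj => /=; rewrite min_r ?ler01 // maxxx. Qed.

Lemma clamp1 : clamp 1 = @I1 R.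
Proof. by apply: val_inj => /=; rewrite minxx max_r ?ler01. Qed.

Lemma clamp_continuous : continuous clamp.
Proof.
apply: continuous_comp_initial => s.
apply: continuous_max; first exact: cvg_cst.
by apply: continuous_min; [exact: cvg_cst|exact: cvg_id].
Qed.
End clamp.

(** * Infinitely many Reidemeister classes *)

Section lifts_of_homotopic_maps.
Variables (R : realType) (n : nat).
Implicit Types f : circle R -> unordered_conf n (circle R).
Local Notation p := (@circle_cover R).

(** A homotopy from [f] to [f'] becomes, through [circle_cover] and [clamp], a
    family of loops indexed by the line; having an equivariant lifting is
    locally constant in the parameter, so it passes from [f'] to [f]. *)
Lemma homotopic_equivariant_lift f f' : homotopic R f f' ->
  (exists g, equivariant_lift (f' \o p) g) ->
  exists g, equivariant_lift (f \o p) g.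
Proof.
move=> [H [Hc H0 H1]] f'g.
pose K (u : R * R) := H (p u.1, clamp u.2).
have Kc : continuous K.
  move=> u Y /Hc[[U V] /= [Uu Vu] UV].
  exists (p @^-1` U, @clamp R @^-1` V) => /=.
    by split; [exact: circle_cover_continuous|exact: clamp_continuous].
  by move=> [t s] /= [Ut Vs]; exact: (UV (p t, clamp s)).
have K1 t s : K (t + 1, s) = K (t, s) by rewrite /K /= circle_cover1.
have K_0 : (fun t => K (t, 0)) = f \o p.
  by apply/funext => t; rewrite /K /= clamp0 H0.
have K_1 : (fun t => K (t, 1)) = f' \o p.
  by apply/funext => t; rewrite /K /= clamp1 H1.
rewrite -K_0; apply: (@locally_constant_all R
  (fun s => exists g, equivariant_lift (fun t => K (t, s)) g) 1).
  exact: equivariant_lift_locally_constant.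
by rewrite K_1.
Qed.

Lemma phi_equivariant_lift (n_gt0 : (0 < n)%N) :
  equivariant_lift (phi n_gt0 n%:Z \o p)
    (fun (i : 'I_n) (t : R) => t + i%:R / n%:R).
Proof.
have n0 : (n%:R : R) != 0 by rewrite pnatr_eq0 -lt0n.
split.
- by move=> i t; apply: cvgD; [exact: cvg_id|exact: cvg_cst].
- move=> i t; rewrite /angles /= /points /= /nth_roots /=.
  rewrite -[RHS]/((set_val (p t) : R[i]) ^+ n) -!circle_coverX mulrDr.
  rewrite [_ * (_ / _)]mulrC divfK //.
  exact: congr1 (circle_coverDz (n%:R * t) (Posz i)).
- move=> t i j ij; rewrite opprD addrACA subrr add0r -mulrBl.
  apply: contra ij => /intrP[m e]; rewrite -(inj_eq val_inj) /=.
  have : (i : int) - (j : int) = m * n.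
    apply/eqP; rewrite -(eqr_int R) intrM intrD mulrNz -!pmulrn -e.
    by rewrite divfK.
  move: (ltn_ord i) (ltn_ord j); move: (i : nat) (j : nat) => k l.
  by have [m0|m0|->] := ltgtP m 0; [nia|nia|lia].
- by move=> i t; rewrite addrAC.
Qed.

Lemma lifting_of_equivariant_lift f g : equivariant_lift (f \o p) g ->
  exists2 F, lifting f F & forall t i, set_val (F t) i = g i t.
Proof.
move=> [gc gf gd g1].
have gP t : (g^~ t : prod_topology (fun _ : 'I_n => R)) \in
    [set u : prod_topology (fun _ : 'I_n => R) |
      forall i j, i != j -> u i - u j \isn't a Num.int].
  by rewrite inE; exact: gd.
exists (fun t => exist (fun u => u \in [set u : prod_topology (fun _ => R) |
    forall i j, i != j -> u i - u j \isn't a Num.int]) _ (gP t)) => //.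
split.
  apply: continuous_comp_initial.
  exact: (@prod_topology_continuous _ _ _ (fun t => g^~ t)).
move=> t; apply: (points_exhaust (distinct_mod_int_inj (gd t))) => i.
exact: gf.
Qed.

Lemma equivariant_lift_addz (L : R -> unordered_conf n (circle R)) g (m : int) :
  equivariant_lift L g -> equivariant_lift L (fun i t => g i t + m%:~R).
Proof.
move=> [gc gL gd g1]; split=> [i t|i t|t i j ij|i t].
- by apply: cvgD; [exact: gc|exact: cvg_cst].
- exact: angles_addz.
- by rewrite opprD addrACA subrr addr0; exact: gd.
- by rewrite g1 addrAC.
Qed.

Lemma infinite_Reidemeister_classes f g : (0 < n)%N ->
  equivariant_lift (f \o p) g -> infinite_set (Reidemeister_classes f).
Proof.
move=> n_gt0 gf; have [gc _ _ g1] := gf; pose i0 := Ordinal n_gt0.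
pose h (m : nat) t := g i0 t + m%:R.
have hf m : lift_factor f (h m).
  have [F Ff FE] := lifting_of_equivariant_lift (equivariant_lift_addz m gf).
  by exists F, i0; split=> //; apply/funext => t; rewrite FE.
have g_addz t (k : int) : g i0 (t + k%:~R) = g i0 t + k%:~R.
  have per u : g i0 (u + 1) - (u + 1) = g i0 u - u by rewrite g1; ring.
  by have := @periodic_addz _ _ (fun u => g i0 u - u) per t k; lra.
pose c m := [set g' | lift_factor f g' /\ lift_equiv g' (h m)].
have c_inj : injective c.
  move=> m m' cm.
  have : c m (h m) by split=> //; exists 0 => t; rewrite add0r subr0.
  (* The shift by - k inside g and the shift by k outside cancel. *)
  rewrite cm => -[_ [k /(_ 0)]]; rewrite /h -mulrNz g_addz mulrNz => e.
  apply/eqP; rewrite -(eqr_nat R); apply/eqP; lra.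
apply/infiniteP; apply: card_le_trans (subset_card_le (A := range c) _).
  rewrite (card_le_eqr (inj_card_eq _)) ?card_lexx // => m m' _ _.
  exact: c_inj.
by move=> _ [m _ <-]; exists (h m).
Qed.

End lifts_of_homotopic_maps.

Theorem theorem5p2 (R : realType) (n : nat) (n_gt0 : (0 < n)%N)
    (f : circle R -> unordered_conf n (circle R)) (f_cont : continuous f)
    (f_deg : has_degree n_gt0 f n%:Z) :
  Reidemeister_number f = +oo%E.
Proof.
have [g gf] := homotopic_equivariant_lift f_deg
  (ex_intro _ _ (phi_equivariant_lift R n_gt0)).
rewrite /Reidemeister_number /counting; case: asboolP => //.
by move/(infinite_Reidemeister_classes n_gt0 gf).
Qed.
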